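(* Let $\Omega$ be an eventually outward quiver with underlying graph $A_{\infty,\infty}$. For each (nonempty) full connected subquiver $\alpha$ of $\Omega$, the isomorphism class of representations $X^\alpha$ of $\Omega$ over a field $\mathbb{F}$ with $X^\alpha_i$ zero-dimensional if $i$ is not in $\alpha$, $X^\alpha_i$ one-dimensional if $i$ is in $\alpha$, and $f_e$ a bijection for each arrow $e$ in $\alpha$, is indecomposable. Moreover, every (possibly infinite-dimensional) representation of $\Omega$ over $\mathbb{F}$ is a direct sum of indecomposables, each isomorphic to $X^\alpha$ for some such $\alpha$.
   Context: A quiver $\Omega$ consists of a set $\Omega_0$ of vertices, a set $\Omega_1$ of arrows, and source and target functions $s,t:\Omega_1\to\Omega_0$. The graph $A_{\infty,\infty}$ has a vertex for each integer and one edge between each pair of consecutive integers; $\Omega$ has underlying graph $A_{\infty,\infty}$ if it is obtained by orienting each edge. $\Omega$ is eventually outward if all but finitely many arrows to the right of vertex $0$ point right and all but finitely many arrows to the left of vertex $0$ point left. A full subquiver is one containing every arrow of $\Omega$ whose source and target it contains. A representation of $\Omega$ over $\mathbb{F}$ consists of an $\mathbb{F}$-vector space $V_i$ for each vertex $i$ and a linear map $f_e:V_{s(e)}\to V_{t(e)}$ for each arrow $e$. It is indecomposable if it is nonzero and is not a direct sum of two proper nonzero subrepresentations. *)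

(* Defs.v *)
From HB Require Import structures.
From Stdlib Require Import Relation_Operators.
From mathcomp Require Import all_boot all_order all_algebra.
From mathcomp Require Import boolp classical_sets functions cardinality fsbigop.

Set Implicit Arguments.
Unset Strict Implicit.
Unset Printing Implicit Defensive.

Import Order.TTheory GRing.Theory Num.Theory.

Local Open Scope classical_set_scope.
Local Open Scope ring_scope.

Record quiver := Quiver {
  vertex : Type;
  arrow : Type;
  src : arrow -> vertex;
  tgt : arrow -> vertex
}.

(* The quivers with underlying graph A_{oo,oo}: the edge between e and e + 1 is
   named e, and o e holds when it is oriented from e to e + 1. *)
Definition orient (o : int -> bool) : quiver :=
  {| vertex := int;
     arrow := int;
     src := fun e => if o e then e else e + 1;
     tgt := fun e => if o e then e + 1 else e |}.

(* The edges to the right of vertex 0 are those named by e >= 0. *)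
Definition eventually_outward (o : int -> bool) : Prop :=
  finite_set [set e : int | 0 <= e /\ ~~ o e] /\
  finite_set [set e : int | e < 0 /\ o e].

Record subquiver (Q : quiver) := Subquiver {
  sub_vertex : set (vertex Q);
  sub_arrow : set (arrow Q);
  sub_srcP : forall e, sub_arrow e -> sub_vertex (src e);
  sub_tgtP : forall e, sub_arrow e -> sub_vertex (tgt e)
}.

Definition full_subquiver (Q : quiver) (a : subquiver Q) : Prop :=
  forall e : arrow Q,
    sub_vertex a (src e) -> sub_vertex a (tgt e) -> sub_arrow a e.

Definition adjacent (Q : quiver) (a : subquiver Q) (i j : vertex Q) : Prop :=
  exists e : arrow Q, [/\ sub_arrow a e, src e = i & tgt e = j].

(* Connectedness of the underlying undirected graph, which must be nonempty. *)
Definition connected_subquiver (Q : quiver) (a : subquiver Q) : Prop :=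
  sub_vertex a !=set0 /\
  forall i j, sub_vertex a i -> sub_vertex a j ->
    clos_refl_sym_trans (vertex Q) (adjacent a) i j.

Record rep (F : fieldType) (Q : quiver) := Rep {
  rep_space : vertex Q -> lmodType F;
  rep_act : forall e : arrow Q, {linear rep_space (src e) -> rep_space (tgt e)}
}.

Definition rep_iso (F : fieldType) (Q : quiver) (X Y : rep F Q) : Prop :=
  exists phi : forall i, {linear rep_space X i -> rep_space Y i},
    (forall i, bijective (phi i)) /\
    (forall (e : arrow Q) (x : rep_space X (src e)),
       phi (tgt e) (rep_act X e x) = rep_act Y e (phi (src e) x)).

Definition has_dim (F : fieldType) (n : nat) (V : lmodType F) : Prop :=
  exists f : {linear V -> 'rV[F]_n}, bijective f.

(* The condition defining X^a. *)
Definition is_X (F : fieldType) (Q : quiver) (a : subquiver Q) (X : rep F Q) :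
    Prop :=
  [/\ forall i, ~ sub_vertex a i -> has_dim 0 (rep_space X i),
      forall i, sub_vertex a i -> has_dim 1 (rep_space X i) &
      forall e, sub_arrow a e -> bijective (rep_act X e)].

Definition is_iso_class (F : fieldType) (Q : quiver) (C : rep F Q -> Prop) :
    Prop :=
  exists X : rep F Q, forall Y : rep F Q, C Y <-> rep_iso X Y.

(* Submodules are the boolean predicates of the library; with the classical
   axioms of boolp these are all the submodules. *)
Record subrep (F : fieldType) (Q : quiver) (V : rep F Q) := Subrep {
  sub_space : forall i, submodClosed (rep_space V i);
  sub_stable : forall (e : arrow Q) (x : rep_space V (src e)),
    x \in sub_space (src e) -> rep_act V e x \in sub_space (tgt e)
}.

Section SubmodSort.
Variables (F : fieldType) (V : lmodType F) (S : submodClosed V).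

Definition submod_sort := {x : V | x \in S}.

HB.instance Definition _ := SubChoice.on submod_sort.
HB.instance Definition _ := [SubChoice_isSubLmodule of submod_sort by <:].

End SubmodSort.

Section RepOfSub.
Variables (F : fieldType) (Q : quiver) (V : rep F Q) (W : subrep V).

Definition sub_act (e : arrow Q) (x : submod_sort (sub_space W (src e))) :
    submod_sort (sub_space W (tgt e)) :=
  exist _ (rep_act V e (val x)) (sub_stable (valP x)).

Fact sub_act_linear e : linear (@sub_act e).
Proof. by move=> c x y; apply: val_inj; rewrite /= linearP. Qed.

HB.instance Definition _ e :=
  GRing.isLinear.Build F _ _ _ (@sub_act e) (@sub_act_linear e).

Definition rep_of_sub : rep F Q :=
  {| rep_space := fun i => submod_sort (sub_space W i) : lmodType F;
     rep_act := fun e => @sub_act e |}.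

End RepOfSub.

Definition rep_nonzero (F : fieldType) (Q : quiver) (V : rep F Q) : Prop :=
  exists (i : vertex Q) (x : rep_space V i), x != 0.

Definition sub_nonzero (F : fieldType) (Q : quiver) (V : rep F Q)
    (W : subrep V) : Prop :=
  exists (i : vertex Q) (x : rep_space V i), x \in sub_space W i /\ x != 0.

Definition sub_proper (F : fieldType) (Q : quiver) (V : rep F Q)
    (W : subrep V) : Prop :=
  exists (i : vertex Q) (x : rep_space V i), x \notin sub_space W i.

(* V is the internal direct sum of the W k: at each vertex, every vector is in
   a unique way a finite sum of vectors taken from the W k. *)
Definition is_direct_sum (F : fieldType) (Q : quiver) (V : rep F Q)
    (I : choiceType) (W : I -> subrep V) : Prop :=
  forall (i : vertex Q) (v : rep_space V i),
    exists! x : I -> rep_space V i,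
      [/\ finite_set [set k | x k != 0],
          forall k, x k \in sub_space (W k) i &
          v = \sum_(k \in [set: I]) x k].

Definition indecomposable (F : fieldType) (Q : quiver) (V : rep F Q) : Prop :=
  rep_nonzero V /\
  ~ exists W : bool -> subrep V,
      (forall b, sub_proper (W b) /\ sub_nonzero (W b)) /\ is_direct_sum W.

(* Main.v *)
From HB Require Import structures.
Require Import Defs.
From Stdlib Require Import Relation_Operators.
From mathcomp Require Import all_boot all_order all_algebra.
From mathcomp Require Import finmap zify.
From mathcomp Require Import boolp classical_sets cardinality fsbigop.

Set Implicit Arguments.
Unset Strict Implicit.
Unset Printing Implicit Defensive.

Import Order.TTheory GRing.Theory Num.Theory.

Local Open Scope classical_set_scope.
Local Open Scope ring_scope.

(** A section of [V] over an interval [p] of the line is a family of vectors,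
    one at each vertex, that is zero outside [p] and that every arrow with
    source in [p] carries along. The multiples of a section form a
    subrepresentation, and if the section has no zero inside [p], this is a copy
    of the interval representation of [p]. So to decompose [V] is to find
    sections over various intervals whose nonzero values at each vertex [m] form
    a basis of the space [V m].

    The vectors of [V m] that extend to a section over [p] form a subspace
    [values V p m]. The possible ends on either side are linearly ordered, by
    [end_rank], in such a way that [values V p m] grows with each end of [p]
    ([values_le]), and two sections that agree at [m] can be glued there
    ([values_glue]). Hence the subspaces [values V p m] are the intersections
    of the members of two chains of subspaces of [V m], one for the left ends
    and one for the right ends. As the quiver is eventually outward, both orders
    are well-founded ([itv_ind]). Two such chains split simultaneously: if one
    chooses, for each [p], a basis of [values V p m] modulo the values of the
    sections over the lower intervals, these bases together form a basis of
    [V m]. They span by well-founded induction ([sec_generate]); in a linear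
    relation between them, the terms of the lexicographically greatest interval
    would be dependent modulo lower values ([sec_independent]).

    What makes the bases at different vertices fit together is
    [lower_hull_vertex]: whether the value of a section over [p] is, modulo
    lower values, a combination of the values of given sections over [p] does
    not depend on the vertex of [p] at which this is tested. It is therefore
    enough to choose the basis at one vertex of [p] and to extend its members to
    sections.

    Conversely, when [X] has one-dimensional spaces on a connected [a], zero
    spaces elsewhere and bijections along [a], a nonzero vector spreads along
    [a] to a section without zeros, which identifies [X] with a model
    ([model_iso]). Such an [X] is indecomposable because at each vertex of [a]
    exactly one of two complementary summands is the whole space, and arrows of
    [a] preserve which one it is ([is_X_indecomposable]). *)

(** * Linear hulls and relative bases *)

Section Hull.
Variables (F : fieldType) (V : lmodType F).
Implicit Types (A B N P : set V) (u v : V) (c : F).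

Definition subspace P : Prop :=
  P 0 /\ forall c u v, P u -> P v -> P (c *: u + v).

Lemma subspaceD P u v : subspace P -> P u -> P v -> P (u + v).
Proof. by move=> [_ PD] Pu Pv; rewrite -[u]scale1r; apply: PD. Qed.

Lemma subspaceZ P c u : subspace P -> P u -> P (c *: u).
Proof. by move=> [P0 PD] Pu; rewrite -[_ *: _]addr0; apply: PD. Qed.

Lemma subspaceN P u : subspace P -> P u -> P (- u).
Proof. by move=> sP Pu; rewrite -scaleN1r; apply: subspaceZ. Qed.

Lemma subspaceB P u v : subspace P -> P u -> P v -> P (u - v).
Proof. by move=> sP Pu Pv; apply: subspaceD => //; apply: subspaceN. Qed.

Lemma subspaceZ_inv P c u : subspace P -> c != 0 -> P (c *: u) -> P u.
Proof.
by move=> sP c0 /(subspaceZ c^-1 sP); rewrite scalerA mulVf // scale1r.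
Qed.

(** The span is taken impredicatively, as the least subspace containing [A]:
    generation and independence can then be discussed without choosing
    coefficients. *)
Definition hull A u : Prop := forall P, subspace P -> A `<=` P -> P u.

Lemma hull_subspace A : subspace (hull A).
Proof.
split=> [P [] // | c u v Hu Hv P sP AP].
by apply: sP.2; [apply: Hu | apply: Hv].
Qed.

Lemma sub_hull A : A `<=` hull A.
Proof. by move=> u Au P _; apply. Qed.

Lemma hull_sub A B : A `<=` hull B -> hull A `<=` hull B.
Proof. by move=> AB u; apply; first exact: hull_subspace. Qed.

Lemma hull_mono A B : A `<=` B -> hull A `<=` hull B.
Proof. by move=> AB; apply: hull_sub => u /AB; apply: sub_hull. Qed.

Definition independent_mod N B : Prop :=
  forall b, B b -> ~ hull (N `|` (B `\ b)) b.

Lemma hull_setU1 A u v :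
  hull (A `|` [set u]) v -> exists c, hull A (v - c *: u).
Proof.
have sH := hull_subspace A.
move=> /(_ (fun w => exists c, hull A (w - c *: u))); apply; first split.
- by exists 0; rewrite scale0r subrr; case: sH.
- move=> c v1 v2 [c1 H1] [c2 H2]; exists (c * c1 + c2).
  have -> : c *: v1 + v2 - (c * c1 + c2) *: u
            = c *: (v1 - c1 *: u) + (v2 - c2 *: u).
    by rewrite scalerBr scalerA scalerDl opprD addrACA.
  by apply: sH.2.
- move=> w [Aw|->].
    by exists 0; rewrite scale0r subr0; apply: sub_hull.
  by exists 1; rewrite scale1r subrr; case: sH.
Qed.

(** If adding [u] made some [b] dependent, then [u] would occur in the
    dependency with a nonzero coefficient, and solving for [u] would place it in
    the span of [N] and [B]. *)
Lemma independent_mod_setU1 N B u :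
  independent_mod N B -> ~ hull (N `|` B) u ->
  independent_mod N (B `|` [set u]).
Proof.
move=> indB Hu b [Bb|->]; last first.
  by apply: contra_not Hu; apply: hull_mono => v [|[[]]] //; [left|right].
have [bu|bu] := pselect (b = u).
  by case: Hu; rewrite -bu; apply: sub_hull; right.
set A := N `|` (B `\ b).
have sub : N `|` ((B `|` [set u]) `\ b) `<=` A `|` [set u].
  by move=> v [Nv|[[Bv|->] vb]]; [left; left|left; right|right].
move=> /(hull_mono sub) /hull_setU1 [c Hb].
have [c0|c0] := eqVneq c 0.
  by apply: (indB b Bb); move: Hb; rewrite c0 scale0r subr0.
apply: Hu; have sH := hull_subspace (N `|` B).
apply: (subspaceZ_inv sH c0).
have -> : c *: u = b - (b - c *: u) by rewrite subKr.
apply: (subspaceB sH); first by apply: sub_hull; right.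
by move: Hb; apply: hull_mono => v [|[]]; [left|right].
Qed.

(** A maximal subset of [S] independent modulo [N], given by Zorn's lemma. The
    spans of a chain of sets are themselves a chain, so that their union is a
    subspace: a dependency in the union of the chain already occurs in one of
    its members. *)
Lemma relative_basis N S : exists B,
  [/\ B `<=` S, S `<=` hull (N `|` B) & independent_mod N B].
Proof.
pose good B := B `<=` S /\ independent_mod N B.
have chain (C : set (set V)) : C `<=` good -> total_on C subset ->
    good (\bigcup_(B in C) B).
  move=> Cgood Ctot; split=> [b [B CB Bb]|b [B CB Bb] Hb].
    exact: (Cgood B CB).1.
  have [D [CD Db HDb]] : exists D, [/\ C D, D b & hull (N `|` (D `\ b)) b].
    suff [D [CD BD HD]] :
        exists D, [/\ C D, B `<=` D & hull (N `|` (D `\ b)) b].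
      by exists D; split=> //; apply: BD.
    apply: (Hb (fun u => exists D,
              [/\ C D, B `<=` D & hull (N `|` (D `\ b)) u])).
      split=> [|c u v [D [CD BD HD]] [D' [CD' BD' HD']]].
        by exists B; split=> //; apply: (hull_subspace _).1.
      case: (Ctot D D') => // sDD.
        exists D'; split=> //; apply: (hull_subspace _).2 => //.
        by move: HD; apply: hull_mono => w [|[/sDD]]; [left|right].
      exists D; split=> //; apply: (hull_subspace _).2 => //.
      by move: HD'; apply: hull_mono => w [|[/sDD]]; [left|right].
    move=> u [Nu|[[D CD Du] ub]].
      by exists B; split=> //; apply: sub_hull; left.
    case: (Ctot B D) => // sBD.
      by exists D; split=> //; apply: sub_hull; right.
    by exists B; split=> //; apply: sub_hull; right; split=> //; apply: sBD.
  exact: (Cgood D CD).2 HDb.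
have [B [[BS indB] maxB]] := Zorn_bigcup chain.
exists B; split=> // u Su; apply: contrapT => Hu.
apply: (maxB (B `|` [set u])).
  split; first exact: subsetUl.
  move=> /(_ u (or_intror erefl)) Bu.
  by apply: Hu; apply: sub_hull; right.
split; last exact: independent_mod_setU1.
by move=> v [/BS|->].
Qed.

End Hull.

(** * Ends of intervals and their order *)

(** For the right ends, [w m] says that the edge between [m] and [m + 1] points
    right. An end at an outward edge forces a section to be killed by that
    arrow, which is the harder the nearer the end is; an end at an inward edge
    is free, and an interval that goes on beyond it forces the vector at [m] to
    come from further away. The order of the ends is therefore: outward ends
    from near to far, then infinity, written [None], then inward ends from far
    to near. *)
Definition end_rank (w : int -> bool) (k : option int) : int *l int :=
  match k with
  | Some m => if w m then (0, m) else (2, - m)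
  | None => (1, 0)
  end.

Definition reach (k : option int) (m : int) : bool :=
  if k is Some n then m <= n else true.

Lemma end_rank_inj (w : int -> bool) : injective (end_rank w).
Proof.
move=> [m|] [n|] //=; last by case: (w n).
  by case: (w m); case: (w n) => // -[] // /eqP; rewrite ?eqr_opp => /eqP ->.
by case: (w m).
Qed.

Lemma end_rank_lt (w : int -> bool) k l :
  (end_rank w k < end_rank w l)%O =
  match k, l with
  | Some m, Some n => if w m then w n ==> (m < n) else ~~ w n && (n < m)
  | Some m, None => w m
  | None, Some n => ~~ w n
  | None, None => false
  end.
Proof.
by case: k l => [m|] [n|] //=; try case: (w m); try case: (w n);
  rewrite ltxi_pair //= ltrN2.
Qed.

Lemma end_rank_out (w : int -> bool) m k : w m -> reach k (m + 1) ->
  (end_rank w (Some m) < end_rank w k)%O.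
Proof.
rewrite end_rank_lt => ->; case: k => [n|] //= mn.
by apply/implyP => _; lia.
Qed.

Lemma end_rank_in (w : int -> bool) m k : ~~ w m -> reach k (m + 1) ->
  (end_rank w k < end_rank w (Some m))%O.
Proof.
move=> wm; rewrite end_rank_lt (negbTE wm); case: k => [n|] //= mn.
by case: (w n); lia.
Qed.

Lemma reach_le k (m n : int) : m <= n -> reach k n -> reach k m.
Proof. by case: k => //= p; apply: le_trans. Qed.

(** Under these bounds the outward ends form an increasing sequence and the
    inward ones a decreasing sequence starting below [M], so that the order type
    is that of two sequences with one point, infinity, between them. *)
Lemma end_rank_ind (w : int -> bool) (M : int) (P : option int -> Prop) :
  (forall m : int, M <= m -> w m) -> (forall m : int, m <= - M -> ~~ w m) ->
  (forall k, (forall l, (end_rank w l < end_rank w k)%O -> P l) -> P k) ->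
  forall k, P k.
Proof.
move=> wM wNM IH.
have PO m : w m -> P (Some m).
  have [n] := ubnP `|(m + M)%R|%N; elim: n m => [m|n IHn m ltn wm].
    by rewrite ltn0.
  have m_gt : - M < m by rewrite ltNge; apply/negP=> /wNM; rewrite wm.
  apply: IH => k; rewrite end_rank_lt; case: k => [k|]; last by rewrite wm.
  case wk: (w k); rewrite wm //= => k_lt.
  have k_gt : - M < k by rewrite ltNge; apply/negP=> /wNM; rewrite wk.
  by apply: IHn; rewrite ?wk //; clear -ltn m_gt k_gt k_lt; lia.
have PN : P None.
  by apply: IH => k; rewrite end_rank_lt; case: k => [k wk|//]; apply: PO.
have PI m : ~~ w m -> P (Some m).
  have [n] := ubnP `|(M - m)%R|%N; elim: n m => [m|n IHn m ltn wm].
    by rewrite ltn0.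
  have m_lt : m < M by rewrite ltNge; apply/negP=> /wM; rewrite (negbTE wm).
  apply: IH => k; rewrite end_rank_lt; case: k => [k|_]; last exact: PN.
  case wk: (w k); first by move=> _; apply: PO.
  rewrite wm /= => k_gt.
  have k_lt : k < M by rewrite ltNge; apply/negP=> /wM; rewrite wk.
  by apply: IHn; rewrite ?wk //; clear -ltn m_lt k_lt k_gt; lia.
by case=> [m|]; [case wm: (w m); [apply: PO | apply: PI; rewrite wm]|].
Qed.

(** The end at which a vector stops when it is carried away from [i] until an
    inward edge blocks the way. *)
Lemma first_in (w : int -> bool) (i : int) : exists k : option int,
  [/\ reach k i, forall m : int, i <= m -> reach k (m + 1) -> w m
    & forall m, k = Some m -> ~~ w m].
Proof.
have [exN|allw] := pselect (exists n : nat, ~~ w (i + n%:Z)); last first.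
  exists None; split=> // m im _; apply: contrapT => /negP wm.
  apply: allw; exists `|(m - i)%R|%N.
  by have -> : i + `|(m - i)%R|%N%:Z = m by lia.
case: (ex_minnP exN) => n wn minn; exists (Some (i + n%:Z)); split=> /=.
- by lia.
- move=> m im mn; apply: contrapT => /negP wm.
  have m_eq : i + `|(m - i)%R|%N%:Z = m by lia.
  have /minn : ~~ w (i + `|(m - i)%R|%N%:Z) by rewrite m_eq.
  by lia.
- by move=> m [<-].
Qed.

Lemma reach_out (w : int -> bool) (m : int) k l : w m ->
  (end_rank w k <= end_rank w l)%O -> reach l m -> reach k (m + 1) ->
  reach l (m + 1).
Proof.
move=> wm kl lm km; apply: contraT => lm1.
have /(end_rank_out wm) : reach k (m + 1) by [].
have -> : Some m = l by case: l lm lm1 {kl} => //= n ? ?; congr Some; lia.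
by rewrite ltNge kl.
Qed.

Lemma reach_in (w : int -> bool) (m : int) k l : ~~ w m ->
  (end_rank w k <= end_rank w l)%O -> reach k m -> reach l (m + 1) ->
  reach k (m + 1).
Proof.
move=> wm kl km lm; apply: contraT => km1.
have /(end_rank_in wm) : reach l (m + 1) by [].
have -> : Some m = k by case: k km km1 {kl} => //= n ? ?; congr Some; lia.
by rewrite ltNge kl.
Qed.

(** * Intervals *)

(** The left end is recorded through its opposite, so that both ends are
    subject to the same rules: an interval reaches [- m] on its left and [m] on
    its right. *)
Definition interval : Type := (option int * option int)%type.

Definition in_itv (p : interval) (m : int) : bool :=
  reach p.1 (- m) && reach p.2 m.

Lemma in_itv_convex p (l m n : int) :
  l <= m -> m <= n -> in_itv p l -> in_itv p n -> in_itv p m.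
Proof.
move=> lm mn /andP[pl _] /andP[_ pn]; apply/andP; split.
  by apply: reach_le pl; lia.
exact: reach_le pn.
Qed.

Section Intervals.
Variable o : int -> bool.
Implicit Types (p q : interval) (e m n : int).

Notation esrc e := (@src (orient o) e : int).
Notation etgt e := (@tgt (orient o) e : int).

(** The orientation of the edges as seen by left ends: the edge from [e] to
    [e + 1] has the coordinate [- (e + 1)] after reflection, and it is outward
    for left ends when it points left. *)
Definition flip (w : int -> bool) (m : int) : bool := ~~ w (- m - 1).

Definition itv_le (q p : interval) : bool :=
  (end_rank (flip o) q.1 <= end_rank (flip o) p.1)%O &&
  (end_rank o q.2 <= end_rank o p.2)%O.

Lemma src_tgtP e :
  (o e /\ esrc e = e /\ etgt e = e + 1) \/
  (~~ o e /\ esrc e = e + 1 /\ etgt e = e).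
Proof. by rewrite /=; case: (o e); [left | right]. Qed.

Lemma flip_edge e : flip o (- (e + 1)) = ~~ o e.
Proof. by rewrite /flip opprK addrK. Qed.

Lemma in_itv_edge p e :
  in_itv p (esrc e) && in_itv p (etgt e) = in_itv p e && in_itv p (e + 1).
Proof. by case: (src_tgtP e) => -[_ [-> ->]] //; rewrite andbC. Qed.

(** The order on the ends is designed for this property, which is what lets a
    section over the lower interval be truncated to the greater one. *)
Lemma itv_le_edge p q e : itv_le q p ->
  in_itv p (esrc e) -> in_itv q (etgt e) ->
  in_itv q (esrc e) /\ in_itv p (etgt e).
Proof.
move=> /andP[le1 le2]; rewrite /in_itv.
have e1 : - (e + 1) + 1 = - e by lia.
case: (src_tgtP e) => -[oe [-> ->]] /andP[p1 p2] /andP[q1 q2].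
- split; apply/andP; split.
  + by rewrite -e1; apply: (reach_in _ le1); rewrite ?flip_edge ?negbK ?e1.
  + by apply: reach_le q2; lia.
  + by apply: reach_le p1; lia.
  + exact: (reach_out oe le2).
- split; apply/andP; split.
  + by apply: reach_le q1; lia.
  + exact: (reach_in oe le2).
  + by rewrite -e1; apply: (reach_out _ le1); rewrite ?flip_edge ?negbK ?e1.
  + by apply: reach_le p2; lia.
Qed.

Lemma itv_connected p (P : int -> Prop) :
  (forall e, in_itv p (esrc e) -> in_itv p (etgt e) ->
     (P (esrc e) <-> P (etgt e))) ->
  forall m n, in_itv p m -> in_itv p n -> P m -> P n.
Proof.
move=> Pe.
have Pe1 m : in_itv p m -> in_itv p (m + 1) -> (P m <-> P (m + 1)).
  move=> pm pm1; have := Pe m; have := in_itv_edge p m.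
  rewrite pm pm1 => /andP[-> ->] /(_ isT isT).
  by case: (src_tgtP m) => -[_ [-> ->]] // [].
have up m k : in_itv p m -> in_itv p (m + k%:Z) -> (P m <-> P (m + k%:Z)).
  move=> pm; elim: k => [|k IHk] pmk; first by rewrite addr0.
  have pk : in_itv p (m + k%:Z) by apply: in_itv_convex pm pmk; lia.
  have mk : m + k.+1%:Z = m + k%:Z + 1 by lia.
  have /(Pe1 _ pk) : in_itv p (m + k%:Z + 1) by rewrite -mk.
  by rewrite -mk => H; apply: iff_trans (IHk pk) H.
move=> m n pm pn.
have [mn|nm] := leP m n.
  have n_eq : n = m + `|(n - m)%R|%N%:Z by lia.
  by rewrite n_eq in pn *; case: (up _ _ pm pn).
have m_eq : m = n + `|(m - n)%R|%N%:Z by lia.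
by rewrite m_eq in pm *; case: (up _ _ pn pm).
Qed.

(** Cutting at an arrow and keeping the side of its source creates an outward
    end, which is lower than any end further away. *)
Definition itv_cut p e : interval :=
  if o e then (p.1, Some e) else (Some (- (e + 1)), p.2).

Lemma in_itv_cut p e m : in_itv p (esrc e) -> in_itv p (etgt e) ->
  in_itv (itv_cut p e) m = in_itv p m && (if o e then m <= e else e < m).
Proof.
rewrite /itv_cut /in_itv.
case: (src_tgtP e) => -[oe [-> ->]] /andP[p1 p2] /andP[q1 q2].
  rewrite oe /=; case me: (m <= e); rewrite ?andbF // !andbT.
  by rewrite (reach_le me p2) andbT.
rewrite (negbTE oe) /= lerN2 lezD1; case em: (e < m); rewrite ?andbF //=.
by rewrite andbT [reach p.1 _](reach_le _ p1) // lerN2 lezD1.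
Qed.

Lemma itv_cut_lt p e : in_itv p (esrc e) -> in_itv p (etgt e) ->
  itv_le (itv_cut p e) p /\ itv_cut p e != p.
Proof.
rewrite /itv_cut /in_itv /itv_le.
case: (src_tgtP e) => -[oe [-> ->]] /andP[p1 p2] /andP[q1 q2].
  have := end_rank_out oe q2.
  rewrite oe lexx => lt2; rewrite (ltW lt2); split=> //.
  by apply: contraTneq lt2 => <-; rewrite ltxx.
have : flip o (- (e + 1)) by rewrite flip_edge.
have e1 : - (e + 1) + 1 = - e by lia.
move=> /end_rank_out/(_ (_ : reach p.1 _)); rewrite e1 => /(_ q1) lt1.
rewrite (negbTE oe) lexx (ltW lt1); split=> //.
by apply: contraTneq lt1 => <-; rewrite ltxx.
Qed.

Lemma finite_int_bounded (A : set int) :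
  finite_set A -> exists M : int, forall m, A m -> - M < m < M.
Proof.
move=> /finite_seqP[s ->]; elim: s => [|n s [M IHs]].
  by exists 0 => m /=; rewrite in_nil.
exists (`|n| + 1 + `|M|) => m /=; rewrite inE => /orP[/eqP->|/IHs]; lia.
Qed.

Lemma itv_ind (P : interval -> Prop) : eventually_outward o ->
  (forall p, (forall q, itv_le q p -> q != p -> P q) -> P p) ->
  forall p, P p.
Proof.
move=> [/finite_int_bounded[M HM] /finite_int_bounded[N HN]] IH.
pose K : int := `|M| + `|N| + 1.
have oK m : K <= m -> o m.
  move=> Km; apply: contrapT => /negP om.
  by have := HM m; rewrite /K in Km; case/(_ _)/andP => [|? ?]; [split|]; lia.
have oNK m : m <= - K -> ~~ o m.
  move=> mK; apply/negP => om.
  by have := HN m; rewrite /K in mK; case/(_ _)/andP => [|? ?]; [split|]; lia.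
have fK m : K <= m -> flip o m by move=> Km; apply: oNK; lia.
have fNK m : m <= - (K + 1) -> ~~ flip o m.
  by move=> mK; rewrite negbK; apply: oK; lia.
have fK' m : K + 1 <= m -> flip o m by move=> Km; apply: fK; lia.
suff H k : forall l, P (k, l) by case=> k l; apply: H.
move: k.
apply: (end_rank_ind fK' fNK) => k IHk.
apply: (end_rank_ind oK oNK) => l IHl.
apply: IH => -[k' l'] /andP[/= lek lel] ne.
have [kk|kk] := eqVneq k' k.
  rewrite kk; apply: IHl; rewrite lt_neqAle lel andbT.
  by apply: contraNneq ne => /end_rank_inj ->; rewrite kk.
apply: IHk; rewrite lt_neqAle lek andbT.
by apply: contraNneq kk => /end_rank_inj ->.
Qed.

End Intervals.

(** * Sections of a representation over an interval *)

Section Sections.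
Variables (F : fieldType) (o : int -> bool) (V : rep F (orient o)).
Implicit Types (p q : interval) (e m n : int).

Notation esrc e := (@src (orient o) e).
Notation etgt e := (@tgt (orient o) e).

Definition family : Type := forall m : int, rep_space V m.
Implicit Types x y : family.

Definition compat x e : Prop := rep_act V e (x (esrc e)) = x (etgt e).

(** Nothing is required of the arrows with source outside [p]: when such an
    arrow enters [p], the interval has an inward end there, and the family may
    take any value at its target. *)
Definition is_section p x : Prop :=
  (forall m, ~~ in_itv p m -> x m = 0) /\
  (forall e, in_itv p (esrc e) -> compat x e).

Definition lin_family (c : F) x y : family := fun m => c *: x m + y m.

Definition truncate p x : family := fun m => if in_itv p m then x m else 0.

Lemma section0 p : is_section p (fun m => 0).
Proof. by split=> // e _; rewrite /compat linear0. Qed.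

Lemma section_lin p c x y : is_section p x -> is_section p y ->
  is_section p (lin_family c x y).
Proof.
move=> [x0 xC] [y0 yC]; split=> [m pm|e pe].
  by rewrite /lin_family x0 // y0 // scaler0 addr0.
by rewrite /compat linearP xC // yC.
Qed.

Lemma section_restrict p q x : itv_le o q p -> is_section q x ->
  is_section p (truncate p x).
Proof.
move=> qp [x0 xC]; split=> [m /negbTE pm|e pe]; rewrite /truncate ?pm //.
rewrite /compat pe.
case qt: (in_itv q (etgt e)).
  have [qs pt] := itv_le_edge qp pe qt.
  by rewrite pt; apply: xC.
rewrite (x0 (etgt e)) ?qt // if_same.
case qs: (in_itv q (esrc e)); first by rewrite xC // x0 ?qt.
by rewrite x0 ?qs // linear0.
Qed.

Definition values p m : set (rep_space V m) :=
  [set v | exists2 x, is_section p x & x m = v].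
Arguments values p m _ : clear implicits.

Lemma values_subspace p m : subspace (values p m).
Proof.
split; first by exists (fun m => 0); first exact: section0.
move=> c _ _ [x sx <-] [y sy <-].
by exists (lin_family c x y) => //; apply: section_lin.
Qed.

Lemma values_le p q m : itv_le o q p -> in_itv p m ->
  values q m `<=` values p m.
Proof.
move=> qp pm _ [x sx <-]; exists (truncate p x); last by rewrite /truncate pm.
exact: section_restrict sx.
Qed.

(** A section over [p] is used up to [m] and a section over [q] from [m] on;
    the rules at the two ends are those of [p] and of [q] respectively. *)
Lemma values_glue p q m v :
  in_itv p m -> in_itv q m -> values p m v -> values q m v ->
  values (p.1, q.2) m v.
Proof.
move=> /andP[p1 p2] /andP[q1 q2] [x [x0 xC] xv] [y [y0 yC] yv].
pose z : family := fun n => if n <= m then x n else y n.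
exists z; last by rewrite /z lexx.
have zx n : n <= m -> z n = x n by rewrite /z => ->.
have zy n : m <= n -> z n = y n.
  rewrite /z => mn; case: ifP => // nm.
  by have -> : n = m by [apply: le_anti; rewrite nm]; rewrite xv yv.
split=> [n|e].
  have [nm|mn] := leP n m => npq.
    rewrite zx // x0 //; apply: contra npq => /andP[pn _].
    by rewrite /in_itv pn /= (reach_le nm).
  rewrite zy ?ltW // y0 //; apply: contra npq => /andP[_ qn].
  by rewrite /in_itv qn andbT /= (reach_le _ p1) //; lia.
move=> /andP[/= se1 se2]; rewrite /compat.
have [em|me] := ltP e m.
  have [sm tm] : esrc e <= m /\ etgt e <= m.
    by case: (src_tgtP o e) => -[_ [-> ->]]; lia.
  rewrite (zx _ sm) (zx _ tm).
  by apply: xC; rewrite /in_itv se1 /= (reach_le sm p2).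
have [sm tm] : m <= esrc e /\ m <= etgt e.
  by case: (src_tgtP o e) => -[_ [-> ->]]; lia.
rewrite (zy _ sm) (zy _ tm).
by apply: yC; rewrite /in_itv se2 andbT (reach_le _ q1) //= lerN2.
Qed.

(** * Extending a vector along the line *)

Section Extension.
Variables (i : int) (v : rep_space V i).

Definition outward e : bool := if o e then i <= e else e < i.

Definition far e : int := if i <= e then e + 1 else e.

(** Carries a family across the edge [e], away from [i]: by the map of the
    representation if the arrow points away from [i], and otherwise by choosing
    a preimage, when there is one. *)
Definition carry x e : family :=
  if outward e then
    @dfwith int (rep_space V) x (etgt e) (rep_act V e (x (esrc e)))
  else match pselect (exists w, rep_act V e w = x (etgt e)) with
       | left H => @dfwith int (rep_space V) x (esrc e) (projT1 (cid H))
       | right _ => x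
       end.

Lemma carry_near x e m : m != far e -> carry x e m = x m.
Proof.
rewrite /carry /outward /far; case: (src_tgtP o e) => -[oe [se te]].
  rewrite oe; case: ifP => ie mf; first by rewrite dfwith_out // te eq_sym.
  case: pselect => // H; by rewrite dfwith_out // se eq_sym.
rewrite (negbTE oe); case: (leP i e) => ie mf.
  by case: pselect => // H; rewrite dfwith_out // se eq_sym.
by rewrite dfwith_out // te eq_sym.
Qed.

Lemma src_neq_tgt e : esrc e != etgt e :> int.
Proof. by case: (src_tgtP o e) => -[_ [-> ->]]; apply/eqP; lia. Qed.

Lemma carry_compat x e :
  outward e \/ (forall u, exists w, rep_act V e w = u) -> compat (carry x e) e.
Proof.
rewrite /compat /carry; case: ifP => [_ _|_ [//|surj]].
  by rewrite dfwith_in dfwith_out // eq_sym src_neq_tgt.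
case: pselect => [H|[]]; last exact: surj.
rewrite dfwith_in dfwith_out ?src_neq_tgt //.
by case: (cid H).
Qed.

(** The [n]-th stage crosses the [n]-th edges on both sides of [i], so that the
    value at a vertex is settled once the stage reaches its distance to [i]. *)
Fixpoint carried (n : nat) : family :=
  if n is k.+1 then carry (carry (carried k) (i + k%:Z)) (i - k%:Z - 1)
  else @dfwith int (rep_space V) (fun m => 0) i v.

Definition extension : family := fun m => carried `|(m - i)%R|%N m.

Lemma carriedE (n : nat) m : (`|(m - i)%R| <= n)%N -> carried n m = extension m.
Proof.
elim: n => [|n IHn]; rewrite /extension.
  by rewrite leqn0 => /eqP ->.
rewrite leq_eqVlt ltnS => /orP[/eqP -> //|mn].
have fr : far (i + n%:Z) = i + n%:Z + 1 by rewrite /far ifT //; lia.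
have fl : far (i - n%:Z - 1) = i - n%:Z - 1 by rewrite /far ifF //; lia.
rewrite [LHS]/= !carry_near ?fr ?fl ?IHn //; apply/eqP; lia.
Qed.

Lemma extension_base : extension i = v.
Proof. by rewrite /extension subrr /= dfwith_in. Qed.

(** The first alternative serves for arbitrary maps, the second for surjective
    ones, across which a vector can be carried against the arrow too. *)
Lemma extension_compat e :
  outward e \/ (forall u, exists w, rep_act V e w = u) -> compat extension e.
Proof.
move=> He; rewrite /compat.
have [es se et te] :
    [/\ e <= esrc e, esrc e <= e + 1, e <= etgt e & etgt e <= e + 1].
  by case: (src_tgtP o e) => -[_ [-> ->]]; split; lia.
have [ie|ei] := leP i e.
  pose n := `|(e - i)%R|%N; have e_eq : i + n%:Z = e by rewrite /n; lia.
  have near m : e <= m -> m <= e + 1 -> extension m = carry (carried n) e m.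
    move=> em me; rewrite -(@carriedE n.+1) /=; last by lia.
    have fl : far (i - n%:Z - 1) = i - n%:Z - 1 by rewrite /far ifF //; lia.
    by rewrite carry_near ?e_eq // fl; apply/eqP; lia.
  rewrite (near _ es se) (near _ et te); exact: carry_compat.
pose n := `|(i - e - 1)%R|%N; have e_eq : i - n%:Z - 1 = e by rewrite /n; lia.
have near m : e <= m -> m <= e + 1 ->
    extension m = carry (carry (carried n) (i + n%:Z)) e m.
  by move=> em me; rewrite -(@carriedE n.+1) /= ?e_eq //; lia.
rewrite (near _ es se) (near _ et te); exact: carry_compat.
Qed.

End Extension.

(** A vector is carried outwards on each side until an inward edge is met,
    where a section is allowed to stop. *)
Lemma exists_values i v : exists2 p, in_itv p i & values p i v.
Proof.
have [l [li lw lo]] := first_in (flip o) (- i).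
have [r [ri rw ro]] := first_in o i.
exists (l, r); first by rewrite /in_itv li ri.
exists (truncate (l, r) (extension v)); last first.
  by rewrite /truncate /in_itv li ri /= extension_base.
have out e : in_itv (l, r) (esrc e) -> in_itv (l, r) (etgt e) /\ outward i e.
  rewrite /in_itv /outward [(l, r).1]/= [(l, r).2]/=.
  case: (src_tgtP o e) => -[oe [-> ->]] /andP[ls rs].
    rewrite oe; case: (leP i e) => ie.
      split=> //; apply/andP; split; first by apply: reach_le ls; lia.
      have : Some e <> r by move=> /esym /ro; rewrite oe.
      case: r rs {ri rw ro} => //= n ? ne.
      by have : e <> n by [move=> ?; apply: ne; congr Some]; lia.
    exfalso; have /lw : - i <= - (e + 1) by lia.
    have -> : - (e + 1) + 1 = - e by lia.
    by rewrite flip_edge oe => /(_ ls).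
  rewrite (negbTE oe); case: (ltP e i) => ie.
    split=> //; apply/andP; split; last by apply: reach_le rs; lia.
    have : Some (- (e + 1)) <> l by move=> /esym /lo; rewrite flip_edge oe.
    case: l ls {li lw lo} => //= n ? ne.
    by have : - (e + 1) <> n by [move=> ?; apply: ne; congr Some]; lia.
  by exfalso; have /rw : i <= e by []; move=> /(_ rs); rewrite (negbTE oe).
split=> [m /negbTE pm|e se]; rewrite /truncate ?pm //.
rewrite /compat se; have [-> oe] := out e se.
by apply: extension_compat; left.
Qed.

End Sections.
Arguments values {F o} V p m _.

(** * Bases of sections *)

Section Bases.
Variables (F : fieldType) (o : int -> bool) (V : rep F (orient o)).
Implicit Types (p q : interval) (e m n : int) (x y b : family V).
Implicit Type C : set (family V).

Notation esrc e := (@src (orient o) e).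
Notation etgt e := (@tgt (orient o) e).

Definition lower p m : set (rep_space V m) :=
  [set v | exists q, [/\ itv_le o q p, q != p, in_itv q m & values V q m v]].
Arguments lower p m _ : clear implicits.

Definition at_vertex C m : set (rep_space V m) := [set b m | b in C].
Arguments at_vertex C m _ : clear implicits.

Definition lower_hull p C m : set (rep_space V m) :=
  hull (lower p m `|` at_vertex C m).
Arguments lower_hull p C m _ : clear implicits.

Lemma lower_hull_values p C m : C `<=` is_section p -> in_itv p m ->
  lower_hull p C m `<=` values V p m.
Proof.
move=> Csec pm u; apply; first exact: values_subspace.
move=> v [[q [qp _ _ qv]]|[b Cb <-]]; first exact: values_le qv.
by exists b => //; apply: Csec.
Qed.

(** The combination that equals [x m] lifts to a section [y], because lower
    sections truncate to sections over [p]. Then [x - y] vanishes at [m], and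
    the value of [y] at [n] is a combination of the same kind: only vanishing
    sections remain to be treated. *)
Lemma lower_hull_of_vanishing p C x m n :
  C `<=` is_section p -> is_section p x -> in_itv p m -> in_itv p n ->
  (forall y, is_section p y -> y m = 0 -> lower_hull p C n (y n)) ->
  lower_hull p C m (x m) -> lower_hull p C n (x n).
Proof.
move=> Csec xsec pm pn vanish Hx.
have sH := hull_subspace (lower p n `|` at_vertex C n).
have [y [ysec yx Hy]] : exists y,
    [/\ is_section p y, y m = x m & lower_hull p C n (y n)].
  apply: (Hx (fun u => exists y,
    [/\ is_section p y, y m = u & lower_hull p C n (y n)])).
    split; first by exists (fun=> 0); split=> //; [exact: section0|exact: sH.1].
    move=> c _ _ [y [ysec <- Hy]] [z [zsec <- Hz]].
    exists (lin_family c y z); split=> //; first exact: section_lin.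
    exact: sH.2.
  move=> _ [[q [qp qNp qm [y ysec <-]]]|[b Cb <-]].
    exists (truncate p y); split; last 1 first.
    - rewrite /truncate pn; case qn: (in_itv q n).
        apply: sub_hull; left; exists q; split=> //.
        by exists y.
      by rewrite ysec.1 ?qn //; exact: sH.1.
    - exact: section_restrict ysec.
    - by rewrite /truncate pm.
  by exists b; split=> //; [apply: Csec|apply: sub_hull; right; exists b].
have /vanish : is_section p (lin_family (-1) y x) by apply: section_lin.
rewrite /lin_family yx scaleN1r addNr => /(_ erefl) Hd.
rewrite -(subrK (y n) (x n)) addrC; apply: (subspaceD sH) => //.
by move: Hd; rewrite scaleN1r addrC.
Qed.

Lemma section_cut p e x : is_section p x ->
  in_itv p (esrc e) -> in_itv p (etgt e) -> x (etgt e) = 0 ->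
  is_section (itv_cut o p e) (truncate (itv_cut o p e) x).
Proof.
move=> [x0 xC] ps pt xt.
split=> [n /negbTE pn|e' se]; rewrite /truncate ?pn // /compat se.
have ps' : in_itv p (esrc e') by move: se; rewrite in_itv_cut // => /andP[].
rewrite xC //; case: ifP => // te.
have [->//|e'e] := eqVneq e' e.
apply: x0; apply/negP => pt'; move/eqP: e'e; apply.
move: se te; rewrite !in_itv_cut // ps' pt' !andTb.
case: (src_tgtP o e') => -[oe' [-> ->]]; case: (o e); lia.
Qed.

(** A section that vanishes at the source of an arrow vanishes at its target;
    one that vanishes at the target restricts to a section on the source side
    of the arrow, and such a shorter interval is lower. *)
Lemma lower_hull_edge p C x e : C `<=` is_section p -> is_section p x ->
  in_itv p (esrc e) -> in_itv p (etgt e) ->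
  (lower_hull p C (esrc e) (x (esrc e)) <->
   lower_hull p C (etgt e) (x (etgt e))).
Proof.
move=> Csec xsec ps pt; split; apply: lower_hull_of_vanishing => // y ysec y0.
  by rewrite -(ysec.2 e ps) y0 linear0; apply: (hull_subspace _).1.
have [cut_le cut_ne] := itv_cut_lt ps pt.
have cs : in_itv (itv_cut o p e) (esrc e).
  by rewrite in_itv_cut // ps; case: (src_tgtP o e) => -[+ [-> _]];
    [move=> ->|move=> /negbTE ->] => /=; lia.
apply: sub_hull; left; exists (itv_cut o p e); split=> //.
exists (truncate (itv_cut o p e) y); last by rewrite /truncate cs.
exact: section_cut.
Qed.

Lemma lower_hull_vertex p C x m n : C `<=` is_section p -> is_section p x ->
  in_itv p m -> in_itv p n ->
  lower_hull p C m (x m) -> lower_hull p C n (x n).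
Proof.
move=> Csec xsec.
apply: (itv_connected (o := o)
         (P := fun m : int => lower_hull p C m (x m))) => e ps pt.
exact: lower_hull_edge.
Qed.

(** The last two clauses hold at all vertices of [p] as soon as they hold at one
    of them. They say nothing if [p] has no vertex, a case settled by the second
    clause. *)
Definition section_basis p C : Prop :=
  [/\ C `<=` is_section p,
      (exists m, in_itv p m) \/ C = set0,
      forall m, in_itv p m -> values V p m `<=` lower_hull p C m &
      forall m b, in_itv p m -> C b -> ~ lower_hull p (C `\ b) m (b m)].

Lemma exists_section_basis p : exists C, section_basis p C.
Proof.
have [[m pm]|pN] := pselect (exists m, in_itv p m); last first.
  exists set0; split=> //; first by right.
  by move=> m pm; case: pN; exists m.
have [B [BS genB indB]] := relative_basis (lower p m) (values V p m).
have /choice[s s_sec] : forall v : rep_space V m,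
    exists x, values V p m v -> is_section p x /\ x m = v.
  move=> v; have [[x xsec xv]|] := pselect (values V p m v).
    by exists x.
  by exists (fun=> 0).
have sB v : B v -> is_section p (s v) /\ s v m = v by move=> /BS /s_sec.
have Csec : s @` B `<=` is_section p by move=> _ [v /sB[]] ? _ <-.
exists (s @` B); split=> //; first by left; exists m.
- move=> n pn _ [x xsec <-]; apply: (lower_hull_vertex (m := m)) => //.
  have /genB : values V p m (x m) by exists x.
  apply: hull_mono => u [|Bu]; [by left|right].
  by exists (s u); [exists u|case: (sB u Bu)].
- move=> n _ pn [v Bv <-] Hv; apply: (indB v Bv).
  have {Hv} : lower_hull p ((s @` B) `\ s v) m (s v m).
    apply: lower_hull_vertex Hv => //; first by move=> b [/Csec].
    by case: (sB v Bv).
  rewrite (sB v Bv).2; apply: hull_mono => u [|[_ [[w Bw <-] wv] <-]].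
    by left.
  by right; rewrite (sB w Bw).2; split=> // wv'; apply: wv; rewrite wv'.
Qed.

(** The intervals [q] allowed here are directed upwards, so that the union of
    their values is a subspace although the right ends are arbitrary. *)
Definition left_lower p m : set (rep_space V m) :=
  [set v | v = 0 \/ exists q, [/\ in_itv q m,
     (end_rank (flip o) q.1 < end_rank (flip o) p.1)%O & values V q m v]].
Arguments left_lower p m _ : clear implicits.

Lemma left_lower_subspace p m : subspace (left_lower p m).
Proof.
split; first by left.
have sV q := values_subspace V q m.
move=> c u v [->|[q [qm qp qu]]] [->|[r [rm rp rv]]].
- by left; rewrite scaler0 addr0.
- by right; exists r; rewrite scaler0 add0r.
- by right; exists q; rewrite addr0; split=> //; apply: subspaceZ.
have maxr (w : int -> bool) k l n : reach k n -> reach l n -> exists k',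
    [/\ reach k' n, (end_rank w k <= end_rank w k')%O,
        (end_rank w l <= end_rank w k')%O & k' = k \/ k' = l].
  move=> kn ln; have [kl|/ltW lk] := leP (end_rank w k) (end_rank w l).
    by exists l; split=> //; right.
  by exists k; split=> //; left.
have /andP[q1 q2] := qm; have /andP[r1 r2] := rm.
have [l [ml ql rl l_eq]] := maxr (flip o) _ _ _ q1 r1.
have [k [mk qk rk _]] := maxr o _ _ _ q2 r2.
have tm : in_itv (l, k) m by rewrite /in_itv ml mk.
right; exists (l, k); split=> //=; first by case: l_eq => ->.
apply: (sV _).2; [apply: values_le qu | apply: values_le rv] => //;
  by apply/andP.
Qed.

(** Gluing replaces the right end, about which nothing is known, by that of
    [p]. *)
Lemma left_lower_values p m : in_itv p m ->
  left_lower p m `&` values V p m `<=` hull (lower p m).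
Proof.
move=> pm v [[->|[q [qm qp qv]]] pv]; first exact: (hull_subspace _).1.
apply: sub_hull; exists (q.1, p.2); split.
- by apply/andP; split=> //=; apply: ltW.
- by apply: contraTneq qp => <-; rewrite ltxx.
- by move: qm pm => /andP[q1 _] /andP[_ p2]; rewrite /in_itv q1 p2.
- exact: values_glue.
Qed.

End Bases.

Arguments lower {F o} V p m _.
Arguments lower_hull {F o V} p C m _.
Arguments left_lower {F o} V p m _.

(** * The interval representations *)

Section LinearMaps.
Variable F : fieldType.
Implicit Types U V : lmodType F.

Lemma linear_bundle U V (f : U -> V) : linear f ->
  exists g : {linear U -> V}, g =1 f.
Proof.
move=> fL; pose fl := GRing.isLinear.Build F U V *:%R f fL.
pose g : {linear U -> V} := HB.pack f fl.
by exists g.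
Qed.

Lemma inj_surj_bij (A B : Type) (f : A -> B) :
  injective f -> (forall b, exists a, f a = b) -> bijective f.
Proof. by move=> fI /choice[g gK]; exists g => // a; apply: fI; rewrite gK. Qed.

Lemma bij_surj (A B : Type) (f : A -> B) b : bijective f -> exists a, f a = b.
Proof. by case=> g _ gK; exists (g b). Qed.

Definition generates U (x : U) : Prop :=
  x != 0 /\ forall y, exists c, y = c *: x.

Lemma scale_inj U (x : U) (c d : F) : x != 0 -> c *: x = d *: x -> c = d.
Proof.
move=> x0 /eqP; rewrite -subr_eq0 -scalerBl scaler_eq0 (negbTE x0) orbF.
by rewrite subr_eq0 => /eqP.
Qed.

Lemma has_dim0P U : has_dim 0 U <-> forall x : U, x = 0.
Proof.
split=> [[f /bij_inj fI] x|U0].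
  by apply: fI; rewrite [LHS]thinmx0 [RHS]thinmx0.
have [g _] := @linear_bundle U 'rV[F]_0 (fun=> 0)
  (fun c u v => esym (etrans (addr0 _) (scaler0 _ c))).
exists g; apply: inj_surj_bij => [x y _|y]; first by rewrite (U0 x) (U0 y).
by exists 0; rewrite [LHS]thinmx0 [RHS]thinmx0.
Qed.

Lemma has_dim1P U : has_dim 1 U <-> exists x : U, generates x.
Proof.
split=> [[f fB]|[x [x0 /choice[c cE]]]].
  have [x fx] := bij_surj (const_mx 1) fB.
  exists x; split=> [|y].
    apply/eqP => x0; move: fx; rewrite x0 linear0 => /matrixP/(_ 0 0)/eqP.
    by rewrite !mxE eq_sym oner_eq0.
  exists (f y 0 0); apply: (bij_inj fB); rewrite linearZ fx /=.
  by apply/matrixP => i j; rewrite !ord1 !mxE mulr1.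
have cL : linear (fun y => const_mx (c y) : 'rV[F]_1).
  move=> a u v; apply/matrixP => i j; rewrite !mxE; apply: (scale_inj x0).
  by rewrite -cE scalerDl -scalerA -!cE.
have [g gE] := linear_bundle cL.
exists g; apply: inj_surj_bij => [u v|v].
  rewrite !gE => /matrixP/(_ 0 0); rewrite !mxE => cuv.
  by rewrite (cE u) (cE v) cuv.
exists (v 0 0 *: x); rewrite gE; apply/matrixP => i j; rewrite !ord1 !mxE.
by apply: (scale_inj x0); rewrite -cE.
Qed.

Lemma generates_bij U V (f : {linear U -> V}) x :
  generates x -> generates (f x) -> bijective f.
Proof.
move=> [x0 xG] [y0 yG]; apply: inj_surj_bij => [u v|v].
  have [[c ->] [d ->]] := (xG u, xG v).
  by rewrite !linearZ => /(scale_inj y0) ->.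
by have [c ->] := yG v; exists (c *: x); rewrite linearZ.
Qed.

Lemma row_bool_inj (b : bool) (v w : 'rV[F]_b) :
  \sum_j v 0 j = \sum_j w 0 j -> v = w.
Proof.
case: b v w => v w; last by rewrite (thinmx0 v) (thinmx0 w).
by rewrite !big_ord1 => vw; apply/matrixP => i j; rewrite !ord1.
Qed.

End LinearMaps.

Section IntervalReps.
Variables (F : fieldType) (o : int -> bool) (a : subquiver (orient o)).
Hypotheses (fulla : full_subquiver a) (conna : connected_subquiver a).

Notation esrc e := (@src (orient o) e).
Notation etgt e := (@tgt (orient o) e).

Lemma is_X_generator (X : rep F (orient o)) i :
  is_X a X -> sub_vertex a i -> exists x : rep_space X i, generates x.
Proof. by move=> [_ X1 _] /X1 /has_dim1P. Qed.

Lemma is_X_vanish (X : rep F (orient o)) i (x : rep_space X i) :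
  is_X a X -> ~ sub_vertex a i -> x = 0.
Proof. by move=> [X0 _ _] /X0 /has_dim0P. Qed.

(** Along the arrows of [a] the maps are surjective, so that a nonzero vector at
    one vertex can be carried to all the others; they are injective, so that it
    never becomes zero. *)
Lemma is_X_section (X : rep F (orient o)) : is_X a X ->
  exists x : family X, (forall i, sub_vertex a i -> x i != 0) /\
    forall e, sub_arrow a e -> compat x e.
Proof.
move=> aX; have [_ _ actB] := aX; have [[i ai] conn] := conna.
have [v [v0 _]] := is_X_generator aX ai.
have xC e : sub_arrow a e -> compat (extension (i := i) v) e.
  by move=> ae; apply: extension_compat; right=> u; apply/bij_surj/actB.
exists (extension (i := i) v); split=> // j aj.
set x := extension _ in xC *.
have iff_x k l : clos_refl_sym_trans _ (adjacent a) k l ->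
    (x k != 0 <-> x l != 0).
  elim=> {j aj k l} [k l [e [ae <- <-]]|//|k l _|k l m _ + _].
  - rewrite -(xC e ae); split; apply: contraNN => /eqP.
      by rewrite -(linear0 (rep_act X e)) => /(bij_inj (actB e ae)) ->.
    by move=> ->; rewrite linear0.
  - by case=> kl lk; split.
  - by move=> kl lm; apply: iff_trans kl lm.
by apply: (iff_x _ _ (conn i j ai aj)).1; rewrite /x extension_base.
Qed.

Definition model_dim (i : vertex (orient o)) : bool := `[< sub_vertex a i >].

(** All the maps are given by a matrix of ones: it is the identity when source
    and target both have dimension one, and zero otherwise. *)
Definition model : rep F (orient o) :=
  {| rep_space := fun i => 'rV[F]_(model_dim i) : lmodType F;
     rep_act := fun e => mulmxr (const_mx 1 : 'M[F]_(model_dim (esrc e),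
                                                   model_dim (etgt e))) |}.

Lemma is_X_model : is_X a model.
Proof.
split=> [i ai|i ai|e ae].
- apply/has_dim0P => /=; have -> : model_dim i = false by apply/asboolPn.
  by move=> x; apply: thinmx0.
- have -> : rep_space model i = ('rV[F]_1 : lmodType F).
    by rewrite /=; have -> : model_dim i = true by apply/asboolP.
  by exists idfun; exists idfun.
- have := asboolT (sub_srcP ae); have := asboolT (sub_tgtP ae).
  rewrite /= -/(model_dim (esrc e)) -/(model_dim (etgt e)).
  case: (model_dim (esrc e)) (model_dim (etgt e)) => [] [] // _ _.
  have -> : const_mx 1 = 1%:M :> 'M[F]_1.
    by apply/matrixP => i j; rewrite !ord1 !mxE.
  by exists idfun => x; rewrite /= mulmx1.
Qed.

Lemma is_X_iso (X Y : rep F (orient o)) : is_X a X -> rep_iso X Y -> is_X a Y.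
Proof.
move=> aX [phi [phiB phiC]]; split=> [i ai|i ai|e ae].
- apply/has_dim0P => y; have [x <-] := bij_surj y (phiB i).
  by rewrite (is_X_vanish x aX ai) linear0.
- apply/has_dim1P; have [x [x0 xG]] := is_X_generator aX ai.
  exists (phi i x); split=> [|y].
    apply: contraNneq x0; rewrite -(linear0 (phi i)).
    by move=> /(bij_inj (phiB i)) ->.
  have [u <-] := bij_surj y (phiB i).
  by have [c ->] := xG u; exists c; rewrite linearZ.
- have [_ _ /(_ e ae) actB] := aX.
  have [psi psiK phiK] := phiB (esrc e).
  apply: (@eq_bij _ _ (phi (etgt e) \o rep_act X e \o psi)).
    apply: bij_comp; last exact: (Bijective phiK psiK).
    exact: bij_comp.
  by move=> y /=; rewrite phiC phiK.
Qed.

Lemma model_iso (Y : rep F (orient o)) : is_X a Y -> rep_iso model Y.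
Proof.
move=> aY; have [y [y0 yC]] := is_X_section aY.
have phiL i : linear (fun v : rep_space model i =>
    (\sum_j (v : 'rV[F]_(model_dim i)) 0 j) *: y i).
  move=> c u v; rewrite scalerA -scalerDl mulr_sumr -big_split /=.
  by congr (_ *: _); apply: eq_bigr => j _; rewrite !mxE.
pose phi i := projT1 (cid (linear_bundle (phiL i))).
have phiE i v : phi i v = (\sum_j (v : 'rV[F]_(model_dim i)) 0 j) *: y i.
  exact: projT2 (cid (linear_bundle (phiL i))) v.
exists phi; split=> [i|e v].
  have [ai|ai] := pselect (sub_vertex a i).
    apply: inj_surj_bij => [u v|u].
      by rewrite !phiE => /(scale_inj (y0 i ai)) /row_bool_inj.
    have [x [x0 xG]] := is_X_generator aY ai.
    have [[c uE] [d yE]] := (xG u, xG (y i)).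
    have d0 : d != 0.
      by apply: contraNneq (y0 i ai) => d0; rewrite yE d0 scale0r.
    exists (const_mx (c / d) : 'rV[F]_(model_dim i)); rewrite phiE.
    rewrite /model_dim asboolT // big_ord1 mxE yE scalerA divfK //.
  apply: inj_surj_bij => [u v _|u].
    apply: row_bool_inj; rewrite !big1 // => j.
      by have := ltn_ord j; rewrite {2}/model_dim asboolF.
    by have := ltn_ord j; rewrite {2}/model_dim asboolF.
  by exists 0; rewrite linear0 (is_X_vanish u aY ai).
have [ae|ae] := pselect (sub_arrow a e).
  rewrite !phiE linearZ (yC e ae) /=; congr (_ *: _).
  have := asboolT (sub_tgtP ae); rewrite -/(model_dim (etgt e)).
  case: (model_dim (etgt e)) => // _; rewrite big_ord1 mxE.
  by apply: eq_bigr => j _; rewrite mxE mulr1.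
have [ta|ta] := pselect (sub_vertex a (etgt e)); last first.
  by rewrite (is_X_vanish (phi _ _) aY ta) [RHS](is_X_vanish _ aY ta).
have sa : ~ sub_vertex a (esrc e) by move=> sa; apply: ae; apply: fulla.
by rewrite (is_X_vanish v is_X_model sa) !linear0.
Qed.

Lemma is_X_iso_class : is_iso_class (@is_X F (orient o) a).
Proof.
by exists model => Y; split=> [/model_iso|]; last exact/is_X_iso/is_X_model.
Qed.

End IntervalReps.

(** * Indecomposability *)

Section Indecomposable.
Variables (F : fieldType) (o : int -> bool) (a : subquiver (orient o)).
Hypothesis conna : connected_subquiver a.

Notation esrc e := (@src (orient o) e).
Notation etgt e := (@tgt (orient o) e).

Lemma fsbig_bool (U : lmodType F) (x : bool -> U) :
  \sum_(b \in [set: bool]) x b = x true + x false.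
Proof.
rewrite (fsbigE [:: true; false]) //; last by case.
by rewrite !big_cons big_nil !in_setT /= addr0.
Qed.

Lemma bool_direct_sum (X : rep F (orient o)) (W : bool -> subrep X) :
  is_direct_sum W -> forall i (v : rep_space X i),
  (exists x : bool -> rep_space X i,
     (forall b, x b \in sub_space (W b) i) /\ v = x true + x false) /\
  (v \in sub_space (W true) i -> v \in sub_space (W false) i -> v = 0).
Proof.
move=> sumW i v; have [x [[_ xW vE] uniq_x]] := sumW i v.
split=> [|vt vf]; first by exists x; rewrite -fsbig_bool.
have in_sum (b0 : bool) : x = fun b => if b == b0 then v else 0.
  apply: uniq_x; split=> [|b|]; first exact: finite_finset.
    by case: eqP => [->|_]; [case: b0 | rewrite rpred0].
  by rewrite fsbig_bool; case: b0; rewrite /= ?addr0 ?add0r.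
have := congr1 (@^~ true) (etrans (esym (in_sum true)) (in_sum false)).
by [].
Qed.

(** Of two complementary summands, one is the whole space at each vertex. An
    arrow of [a] carries the summand that is full at its source onto its target.
    By connectedness the same summand is then full everywhere, hence not
    proper. *)
Lemma is_X_indecomposable (X : rep F (orient o)) :
  is_X a X -> indecomposable X.
Proof.
move=> aX; have [[i ai] conn] := conna.
split; first by have [x [x0 _]] := is_X_generator aX ai; exists i, x.
move=> [W [Wproper /bool_direct_sum sumW]].
pose full b j := forall v : rep_space X j, v \in sub_space (W b) j.
have full_or j : full true j \/ full false j.
  have [aj|aj] := pselect (sub_vertex a j); last first.
    by left=> v; rewrite (is_X_vanish v aX aj) rpred0.
  have [x [x0 xG]] := is_X_generator aX aj.
  have [[y [yW xE]] _] := sumW j x.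
  have fullP b : y b != 0 -> full b j.
    move=> yb0 v; have [[c yE] [d ->]] := (xG (y b), xG v).
    have c0 : c != 0 by apply: contraNneq yb0 => c0; rewrite yE c0 scale0r.
    by rewrite -(divfK c0 d) -scalerA -yE rpredZ.
  have [yt|/fullP] := eqVneq (y true) 0; last by left.
  right; apply: fullP; apply: contraNneq x0 => yf.
  by rewrite xE yt yf addr0.
have full_neg b j : ~ full b j -> full (~~ b) j.
  by case: b (full_or j) => [] [].
have full_xor b j : sub_vertex a j -> full b j -> ~ full (~~ b) j.
  move=> aj fb fNb; have [x [x0 _]] := is_X_generator aX aj.
  move/eqP: x0; apply; apply: (sumW j x).2.
    by case: b fb fNb => fb fNb; [apply: fb|apply: fNb].
  by case: b fb fNb => fb fNb; [apply: fNb|apply: fb].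
have full_arrow b e : sub_arrow a e -> full b (esrc e) -> full b (etgt e).
  move=> ae fb v; have [_ _ actB] := aX.
  have [u <-] := bij_surj v (actB e ae).
  exact/sub_stable/fb.
have full_conn b k l : clos_refl_sym_trans _ (adjacent a) k l ->
    (sub_vertex a k -> sub_vertex a l -> (full b k <-> full b l)) /\
    (sub_vertex a k <-> sub_vertex a l).
  elim=> {k l} [k l [e [ae <- <-]]|//|k l _ [IH kl]|k l m _ [IH kl] _ [IH' lm]].
  - split=> [sa ta|]; last by split=> _; [apply: sub_tgtP|apply: sub_srcP].
    split; first exact: full_arrow.
    move=> ft; apply: contrapT => /full_neg/(full_arrow _ _ ae).
    exact: full_xor.
  - by split=> [ak al|]; [case: (IH al ak)|case: kl]; split.
  - split=> [ak am|]; last by split=> [/kl/lm|/lm/kl].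
    have al : sub_vertex a l by apply/kl.
    by split=> [/(IH ak al)/(IH' al am)|/(IH' al am)/(IH ak al)].
have full_all b : full b i -> forall j, full b j.
  move=> fb j; have [aj|aj] := pselect (sub_vertex a j).
    exact/((full_conn b i j (conn i j ai aj)).1 ai aj).
  by move=> v; rewrite (is_X_vanish v aX aj) rpred0.
have [b fb] : exists b, full b i.
  by case: (full_or i) => ?; [exists true | exists false].
by have [[j [v /negP nv]] _] := Wproper b; apply/nv/full_all.
Qed.

End Indecomposable.

(** * Decomposition *)

Lemma seq_max (T : eqType) d (R : orderType d) (f : T -> R) (s : seq T) :
  s != [::] -> exists2 y, y \in s & forall z, z \in s -> (f z <= f y)%O.
Proof.
elim: s => // x [|y s] IHs _.
  by exists x; [|move=> z]; rewrite inE // => /eqP ->.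
have [//|m ms mmax] := IHs.
have [xm|/ltW mx] := leP (f x) (f m).
  by exists m => [|z]; rewrite inE ?ms ?orbT // => /orP[/eqP-> //|/mmax].
exists x => [|z]; rewrite inE ?eqxx // => /orP[/eqP-> //|/mmax zm].
exact: le_trans mx.
Qed.

Section Decomposition.
Variables (F : fieldType) (o : int -> bool) (V : rep F (orient o)).
Variable B : interval -> set (family V).
Hypothesis Bbasis : forall p, section_basis p (B p).
Hypothesis ho : eventually_outward o.

Notation esrc e := (@src (orient o) e).
Notation etgt e := (@tgt (orient o) e).

Definition index : choiceType :=
  {classic {t : interval * family V | B t.1 t.2}}.

Definition itv (k : index) : interval := (sval k).1.
Definition sec (k : index) : family V := (sval k).2.

Lemma sec_basis k : B (itv k) (sec k).
Proof. exact: svalP k. Qed.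

Lemma sec_section k : is_section (itv k) (sec k).
Proof. by have [H _ _ _] := Bbasis (itv k); apply/H/sec_basis. Qed.

Lemma sec_inj k l : itv k = itv l -> sec k = sec l -> k = l.
Proof.
case: k l => [[p x] Bk] [[q y] Bl]; rewrite /itv /sec /= => pq xy.
by apply: eq_exist; rewrite pq xy.
Qed.

Lemma sec_neq0 k m : in_itv (itv k) m -> sec k m != 0.
Proof.
move=> km; apply/eqP => k0; have [_ _ _] := Bbasis (itv k).
move=> /(_ m (sec k) km (sec_basis k)); apply.
by rewrite /lower_hull k0; apply: (hull_subspace _).1.
Qed.

Lemma sec_generate m (v : rep_space V m) :
  hull [set sec k m | k in [set: index]] v.
Proof.
have [p pm pv] := exists_values v.
move: p v pm pv; apply: (itv_ind ho) => p IHp v pm.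
have [_ _ gen _] := Bbasis p.
move=> /(gen m pm); apply: (@hull_sub)  => u [[q [qp qNp qm qu]]|[b Bb <-]].
  exact: IHp qu.
by apply: sub_hull; exists (exist _ (p, b) Bb).
Qed.

(** Let [p] be the lexicographically greatest interval of the relation, left
    ends first, and solve for one of its terms. The terms with the same left end
    are values of other basis sections over [p] or lower values; the remaining
    ones have lower left ends, and their sum, being also a value of a section
    over [p], is a combination of lower values. This contradicts the choice of
    the basis over [p]. *)
Lemma sec_independent m (c : index -> F) (s : seq index) :
  uniq s -> (forall k, k \in s -> c k != 0 /\ in_itv (itv k) m) ->
  \sum_(k <- s) c k *: sec k m = 0 -> s = [::].
Proof.
move=> us sc sum0; apply/eqP; apply: contraT => s0.
pose rk (k : index) : (int *l int) *l (int *l int) :=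
  (end_rank (flip o) (itv k).1, end_rank o (itv k).2).
have [k ks kmax] := seq_max rk s0.
have [ck km] := sc k ks.
set p := itv k in km; pose H := lower_hull p (B p `\ sec k) m.
have [Bsec _ _ indB] := Bbasis p.
have sB : B p `\ sec k `<=` is_section p by move=> b [/Bsec].
case: (indB m (sec k) km (sec_basis k)).
have sH : subspace H by apply: hull_subspace.
have sL := left_lower_subspace V p m.
pose P u := exists h l, [/\ u = h + l, H h & left_lower V p m l].
have sP : subspace P.
  split; first by exists 0, 0; rewrite addr0; split; [|exact: sH.1|exact: sL.1].
  move=> d _ _ [h [l [-> Hh Hl]]] [h' [l' [-> Hh' Hl']]].
  exists (d *: h + h'), (d *: l + l'); split; [|exact: sH.2|exact: sL.2].
  by rewrite scalerDr addrACA.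
have Pk l : l \in s -> l != k -> P (c l *: sec l m).
  move=> ls lk; have [_ lm] := sc l ls.
  apply: (subspaceZ _ sP); have := kmax l ls.
  have lv : values V (itv l) m (sec l m).
    by exists (sec l); first exact: sec_section.
  rewrite /rk lexi_pair => /andP[le1 le2].
  have [lt1|ge1] := ltP (end_rank (flip o) (itv l).1) (end_rank (flip o) p.1).
    exists 0, (sec l m); rewrite add0r; split=> //; first exact: sH.1.
    by right; exists (itv l).
  rewrite ge1 /= in le2.
  exists (sec l m), 0; rewrite addr0; split=> //; last exact: sL.1.
  have [lp|lp] := eqVneq (itv l) p; apply: sub_hull; [right|left].
    exists (sec l) => //; split; first by rewrite /= -lp; apply: sec_basis.
    by move=> /= /(sec_inj lp) /eqP; rewrite (negbTE lk).
  by exists (itv l); split=> //; apply/andP.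
have [h [l [kE Hh Hl]]] : P (c k *: sec k m).
  have -> : c k *: sec k m = - \sum_(l <- s | l != k) c l *: sec l m.
    apply/eqP; rewrite -addr_eq0; apply/eqP.
    by rewrite -[RHS]sum0 [RHS](bigD1_seq k ks us).
  apply: (subspaceN sP); rewrite big_seq_cond.
  apply: (big_ind P) => [|u v|l /andP[]]; first exact: sP.1.
    exact: subspaceD.
  exact: Pk.
have lE : l = c k *: sec k m - h by rewrite kE addrC addKr.
apply: (subspaceZ_inv sH ck); rewrite kE; apply: (subspaceD sH) => //.
have : hull (lower V p m) l.
  apply: left_lower_values => //; split=> //; rewrite lE.
  have sV := values_subspace V p m.
  apply: (subspaceB sV); last exact: lower_hull_values Hh.
  by apply: (subspaceZ _ sV); exists (sec k) => //; apply: sec_section.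
by apply: hull_mono => u; left.
Qed.

(** * The summands *)

Section Line.
Variables (U : lmodType F) (u : U).

Definition line : {pred U} := fun v => `[< exists c, v = c *: u >].

Lemma lineP v : reflect (exists c, v = c *: u) (v \in line).
Proof. exact: asboolP. Qed.

Fact line_closed : subsemimod_closed line.
Proof.
split=> [|c v /lineP[d ->]]; last first.
  by apply/lineP; exists (c * d); rewrite scalerA.
split=> [|v w /lineP[c ->] /lineP[d ->]]; apply/lineP.
  by exists 0; rewrite scale0r.
by exists (c + d); rewrite scalerDl.
Qed.

HB.instance Definition _ := GRing.isSubmodClosed.Build F U line line_closed.

End Line.

Fact sec_stable k e (v : rep_space V (esrc e)) :
  v \in line (sec k (esrc e)) -> rep_act V e v \in line (sec k (etgt e)).
Proof.
move=> /lineP[c ->]; apply/lineP; have [s0 sC] := sec_section k.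
case ks: (in_itv (itv k) (esrc e)).
  by exists c; rewrite linearZ (sC e ks).
by exists 0; rewrite s0 ?ks // scaler0 linear0 scale0r.
Qed.

Definition summand (k : index) : subrep V :=
  {| sub_space := fun m => line (sec k m) : submodClosed (rep_space V m);
     sub_stable := @sec_stable k |}.

Lemma fsum_seq (U : lmodType F) (x : index -> U) (A : set index) :
  finite_set A -> (forall k, x k != 0 -> A k) ->
  \sum_(k \in [set: index]) x k = \sum_(k <- fset_set A) x k.
Proof.
move=> finA xA; apply: fsbigTE => k; apply: contraNeq => /xA Ak.
by rewrite in_fset_set // inE.
Qed.

Lemma summand_direct_sum : is_direct_sum summand.
Proof.
move=> m v.
pose ok x (v : rep_space V m) := [/\ finite_set [set k | x k != 0],
  forall k, x k \in sub_space (summand k) m &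
  v = \sum_(k \in [set: index]) x k].
have [x xv] : exists x, ok x v.
  have /(_ (fun u => exists x, ok x u)) gen := sec_generate v.
  apply: gen => [|_ [k _ <-]]; first split.
  - exists (fun=> 0); split=> [|k|]; last by rewrite fsbig1.
      by apply: sub_finite_set (finite_set0 _) => k /=; rewrite eqxx.
    exact: rpred0.
  - move=> c u w [x [finx xW ->]] [y [finy yW ->]].
    have fin : finite_set ([set k | x k != 0] `|` [set k | y k != 0]).
      by rewrite finite_setU.
    have sub k : c *: x k + y k != 0 -> x k != 0 \/ y k != 0.
      have [->|] := eqVneq (x k) 0; last by left.
      by rewrite scaler0 add0r; right.
    exists (fun k => c *: x k + y k); split=> [|k|].
    + by apply: sub_finite_set fin => k /sub.
    + by rewrite rpredD ?rpredZ.
    + rewrite !(fsum_seq fin) ?scaler_sumr ?big_split //.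
        by move=> k; right.
      by move=> k; left.
  - exists (fun l => if l == k then sec k m else 0); split=> [|l|].
    + apply: sub_finite_set (finite_set1 k) => l /=.
      by case: (eqVneq l k) => //; rewrite eqxx.
    + case: eqP => [->|_]; last exact: rpred0.
      by apply/lineP; exists 1; rewrite scale1r.
    + rewrite (fsum_seq (finite_set1 k)); last first.
        by move=> l; case: (eqVneq l k) => //; rewrite eqxx.
      by rewrite fset_set1 big_seq_fset1 eqxx.
exists x; split=> // y [finy yW vy]; have [finx xW vx] := xv.
pose d k := x k - y k.
set D := [set k | x k != 0] `|` [set k | y k != 0].
have fin : finite_set D by rewrite finite_setU.
have dW k : exists c, d k = c *: sec k m.
  by apply/lineP; exact: (rpredB (xW k) (yW k)).
have /choice[c cE] := dW.
pose s := [seq k <- fset_set D | d k != 0].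
have s0 : s = [::].
  apply: (@sec_independent m c); first by rewrite filter_uniq.
    move=> k; rewrite mem_filter => /andP[]; rewrite cE scaler_eq0 negb_or.
    move=> /andP[-> sk] _; split=> //; apply: contraNT sk => km.
    by rewrite (sec_section k).1.
  have -> : \sum_(k <- s) c k *: sec k m = \sum_(k <- s) d k.
    by apply: eq_bigr => k _; rewrite cE.
  rewrite big_filter big_rmcond => [|k]; last by rewrite negbK => /eqP.
  rewrite sumrB -!(fsum_seq fin) -?vx -?vy ?subrr // => k; by [left|right].
apply/funext => k; apply/eqP; rewrite -subr_eq0 -/(d k).
apply: contraT => dk; suff : k \in s by rewrite s0.
rewrite mem_filter dk in_fset_set // inE /=.
have [xk|] := eqVneq (x k) 0; last by left.
by right; apply: contraNneq dk => yk; rewrite /d xk yk subrr.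
Qed.

Definition itv_subquiver (p : interval) : subquiver (orient o) :=
  @Subquiver (orient o) [set m : int | in_itv p m]
    [set e : int | in_itv p (esrc e) /\ in_itv p (etgt e)]
    (fun e => @proj1 _ _) (fun e => @proj2 _ _).

Lemma itv_subquiver_connected p m :
  in_itv p m -> connected_subquiver (itv_subquiver p).
Proof.
move=> pm; split=> [|i j pi pj]; first by exists m.
pose R (n : int) := clos_refl_sym_trans (vertex (orient o))
  (adjacent (itv_subquiver p)) i n.
apply: (itv_connected (o := o) (P := R) _ pi pj (rst_refl _ _ _)) => e ps pt.
have st : adjacent (itv_subquiver p) (esrc e) (etgt e).
  by exists e.
by split=> H; apply: rst_trans H _; [|apply: rst_sym]; apply: rst_step.
Qed.

Lemma sec_support k : exists m, in_itv (itv k) m.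
Proof.
have [_ [//|B0] _ _] := Bbasis (itv k).
by have := sec_basis k; rewrite B0.
Qed.

Lemma summand_generates k m (u : rep_space (rep_of_sub (summand k)) m) :
  in_itv (itv k) m -> val u = sec k m -> generates u.
Proof.
move=> km uE; split.
  by apply: contraNneq (sec_neq0 km) => u0; rewrite -uE u0.
move=> y; have /lineP[c yE] : val y \in line (sec k m) := valP y.
by exists c; apply: val_inj; rewrite yE -uE.
Qed.

Lemma summand_is_X k :
  is_X (itv_subquiver (itv k)) (rep_of_sub (summand k)).
Proof.
have gen m : in_itv (itv k) m ->
    exists2 u : rep_space (rep_of_sub (summand k)) m,
      val u = sec k m & generates u.
  move=> km; have mem : sec k m \in line (sec k m).
    by apply/lineP; exists 1; rewrite scale1r.
  by exists (exist _ (sec k m) mem) => //; apply: summand_generates.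
split=> [m km|m /gen[u _ uG]|e [ks kt]].
- apply/has_dim0P => u; apply: val_inj.
  have /lineP[c ->] : val u \in line (sec k m) := valP u.
  by rewrite (sec_section k).1 ?scaler0 //; apply/negP.
- by apply/has_dim1P; exists u.
- have [u uE uG] := gen _ ks.
  apply: (generates_bij uG); apply: summand_generates => //=.
  by rewrite uE (sec_section k).2.
Qed.

End Decomposition.

Lemma rep_iso_refl (F : fieldType) (Q : quiver) (X : rep F Q) : rep_iso X X.
Proof.
exists (fun i => idfun : {linear rep_space X i -> rep_space X i}).
by split=> // i; exists idfun.
Qed.

Theorem proposition7p1 (F : fieldType) (o : int -> bool)
    (ho : eventually_outward o) :
  (forall a : subquiver (orient o),
     full_subquiver a -> connected_subquiver a ->
     is_iso_class (@is_X F (orient o) a) /\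
     (forall X : rep F (orient o), is_X a X -> indecomposable X)) /\
  (forall V : rep F (orient o),
     exists (I : choiceType) (W : I -> subrep V),
       is_direct_sum W /\
       (forall k : I,
          indecomposable (rep_of_sub (W k)) /\
          (exists a : subquiver (orient o),
             [/\ full_subquiver a, connected_subquiver a &
                 exists X : rep F (orient o),
                   is_X a X /\ rep_iso X (rep_of_sub (W k))]))).
Proof.
split=> [a fulla conna|V].
  by split=> [|X]; [exact: is_X_iso_class | exact: is_X_indecomposable].
have /choice[B Bbasis] := @exists_section_basis F o V.
exists (index B), (summand Bbasis); split=> [|k].
  exact: summand_direct_sum.
have [m km] := sec_support Bbasis k.
have conna := itv_subquiver_connected o km.
have aX := summand_is_X Bbasis k.
split; first exact: is_X_indecomposable aX.
exists (itv_subquiver o (itv k)); split=> //.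
by exists (rep_of_sub (summand Bbasis k)); split=> //; apply: rep_iso_refl.
Qed.
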